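(* Let $r\ge1$, $\alpha_0,\ldots,\alpha_r\in\mathbb{R}\setminus\{0\}$ and $A>\max_{j\in\{0,\ldots,r\}}|\alpha_j|$. Then for all discrete sequences $(\lambda_k)_k$ in $\mathbb{R}_{>0}$, the set $$W:=\{s\in[-A,A];\ \alpha_0-s,\ldots,\alpha_r-s\text{ and }(\lambda_k)_k\text{ satisfy the }\tilde q\text{-criterion}\}\setminus\{\alpha_0,\ldots,\alpha_r\},$$ as a subset of $[-A,A]$, is the complement of a nowhere dense, countable set.
   Context: A sequence $(\lambda_k)_k$ in $\mathbb{C}$ is called discrete if $\inf\{|\lambda-\mu|;\ \lambda,\mu\in\{\lambda_k;k\in\mathbb{N}\},\ \lambda\neq\mu\}>0$. Put $h:=1/(r+1)$. For $\gamma_0,\ldots,\gamma_r\in\mathbb{R}\setminus\{0\}$ and $m_0,\ldots,m_r>0$ define $$\tilde q(m_0,\ldots,m_r):=\begin{pmatrix}1&\gamma_r^{-1}m_r^{-1}t_r\end{pmatrix}\begin{pmatrix}1&\gamma_{r-1}^{-1}m_{r-1}^{-1}t_{r-1}\\ \gamma_{r-1}m_{r-1}t_{r-1}&1\end{pmatrix}\cdots\begin{pmatrix}1&\gamma_1^{-1}m_1^{-1}t_1\\ \gamma_1m_1t_1&1\end{pmatrix}\begin{pmatrix}m_0^{-1}t_0\\ \gamma_0\end{pmatrix},$$ $t_j=\tanh(m_jh)$ (the product of $2\times2$ matrices runs over indices $r-1,\ldots,1$; it is the identity if $r=1$). The numbers $\gamma_0,\ldots,\gamma_r$ and a discrete sequence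 $(\lambda_k)_k$ in $\mathbb{R}_{>0}$ satisfy the $\tilde q$-criterion if there exists $\delta_0\in(0,\min_k\lambda_k)$ such that for all $\delta\in[-\delta_0,\delta_0]$ and all $k\in\mathbb{N}$, $\tilde q(m_0,\ldots,m_r)\neq0$ with $m_j=\sqrt{\lambda_k+\operatorname{sgn}(\gamma_j)\delta}$. In the definition of $W$ the criterion is applied with $\gamma_j=\alpha_j-s$. A set is nowhere dense if its closure has empty interior. *)

(* Defs.v *)
From mathcomp Require Import all_boot all_order all_algebra.
From mathcomp Require Import all_classical all_reals all_analysis.

Set Implicit Arguments.
Unset Strict Implicit.
Unset Printing Implicit Defensive.

Import Order.TTheory GRing.Theory Num.Theory.
Import numFieldNormedType.Exports.

Local Open Scope classical_set_scope.
Local Open Scope ring_scope.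

Definition tanh (R : realType) (x : R) : R :=
  (expR x - expR (- x)) / (expR x + expR (- x)).

(* The infimum is taken in \bar R, so that it is +oo when lam takes only one
   value: constant sequences are discrete. *)
Definition discrete_seq (R : realType) (lam : nat -> R) : Prop :=
  (0 < ereal_inf [set d : \bar R | exists x y : R,
     [/\ range lam x, range lam y, x <> y & d = `|x - y|%:E]])%E.

Section QTilde.
Variables (R : realType) (r : nat) (gamma m : 'I_r.+1 -> R).

Definition tq (j : 'I_r.+1) : R := tanh (m j * (r.+1%:R)^-1).

Definition qrow : 'rV[R]_2 :=
  (row_mx 1%:M ((gamma ord_max)^-1 * (m ord_max)^-1 * tq ord_max)%:M
     : 'rV[R]_(1 + 1)).

Definition qmat (j : 'I_r.+1) : 'M[R]_2 :=
  (block_mx 1%:M ((gamma j)^-1 * (m j)^-1 * tq j)%:M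
            (gamma j * m j * tq j)%:M 1%:M : 'M[R]_(1 + 1)).

Definition qcol : 'cV[R]_2 :=
  (col_mx ((m ord0)^-1 * tq ord0)%:M (gamma ord0)%:M : 'cV[R]_(1 + 1)).

(* The reversed enumeration makes the index decrease from r - 1 to 1 from left
   to right. *)
Definition q_tilde : R :=
  (qrow *m (\prod_(j <- rev (enum 'I_r.+1) | (0 < j < r)%N) qmat j) *m qcol)
    ord0 ord0.

End QTilde.

(* [forall k, delta0 < lam k] says delta0 < min_k (lam k): a discrete sequence
   of positive reals attains its minimum. *)
Definition q_tilde_criterion (R : realType) (r : nat)
    (gamma : 'I_r.+1 -> R) (lam : nat -> R) : Prop :=
  exists delta0 : R,
    [/\ 0 < delta0, forall k, delta0 < lam k &
      forall delta, - delta0 <= delta <= delta0 -> forall k,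
        q_tilde gamma (fun j => Num.sqrt (lam k + Num.sg (gamma j) * delta))
          != 0].

Definition W (R : realType) (r : nat) (alpha : 'I_r.+1 -> R) (A : R)
    (lam : nat -> R) : set R :=
  [set s | s \in `[- A, A] /\ q_tilde_criterion (fun j => alpha j - s) lam]
    `\` range alpha.

Definition nowhere_dense (T : topologicalType) (S : set T) : Prop :=
  interior (closure S) = set0.

(* Main.v *)
(* Up to the factor sqrt(lambda), q~ is a rational function of s, of the t_j
   and of the ratios rho_j = m_j / sqrt(lambda), regular for s off the
   alpha_j. As lambda tends to infinity, t_j and rho_j tend to 1 uniformly
   in small delta, and the limit is prod_j (1 + gamma_(j-1) / gamma_j),
   which vanishes only at the midpoints (alpha_(j-1) + alpha_j) / 2. So off
   the alpha_j and the midpoints only the finitely many small values of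
   lambda matter, and for these it is enough, by continuity, that q~ does
   not vanish at delta = 0. For a fixed lambda that happens for all but
   finitely many s: the numerator is a polynomial in s, positive for s < min
   alpha_j since then all entries of the matrices are positive. The
   criterion thus holds near every point outside a countable set, which
   therefore contains the closure of the complement of W; a countable set
   has empty interior in [-A, A]. *)
Require Import Defs.
From mathcomp Require Import all_boot all_order all_algebra.
From mathcomp Require Import all_classical all_reals all_analysis.
From mathcomp Require Import ring lra.

Set Implicit Arguments.
Unset Strict Implicit.
Unset Printing Implicit Defensive.

Import Order.TTheory GRing.Theory Num.Theory.
Import numFieldNormedType.Exports.

Local Open Scope classical_set_scope.
Local Open Scope ring_scope.

(* The product of the matrices [1, u_j/g_j; g_j v_j, 1], j = n, ..., 1, applied
   to the column (u_0, g_0). The first row of the factor at j = r is qrow, so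
   q~ is the first entry for n = r, u_j = t_j / m_j and v_j = m_j t_j. *)
Fixpoint qrec (F : fieldType) (g u v : nat -> F) (n : nat) : F * F :=
  if n is n'.+1 then
    let z := qrec g u v n' in
    (z.1 + u n / g n * z.2, g n * v n * z.1 + z.2)
  else (u 0%N, g 0%N).

(** * Algebra and continuity of the recursion *)

Section Recursion.
Variable F : fieldType.
Implicit Types g u v : nat -> F.

Lemma eq_qrec g u v g' u' v' n :
  (forall j, (j <= n)%N -> [/\ g j = g' j, u j = u' j & v j = v' j]) ->
  qrec g u v n = qrec g' u' v' n.
Proof.
elim: n => [|n IHn] e; first by case: (e 0%N (leqnn _)) => /= -> -> _.
have [/= -> -> ->] := e n.+1 (leqnn _).
by rewrite IHn // => j jn; apply: e; exact: leqW.
Qed.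

(** Conjugating each matrix by diag(c, 1) multiplies [u] and divides [v] by c. With c = sqrt(lambda)
    this trades the m_j for the ratios rho_j. *)
Lemma qrec_scale (c : F) g u v n : c != 0 ->
  qrec g (fun j => c * u j) (fun j => v j / c) n =
  (c * (qrec g u v n).1, (qrec g u v n).2).
Proof.
move=> c0; elim: n => //= n ->; congr pair => /=; first by ring.
by rewrite !mulrA divfK.
Qed.

(** Each matrix has rank one here, so the vector after n steps is a multiple of (1, g_n), and the
    next step multiplies its first entry by 1 + g_n / g_(n+1). This is the limit for lambda tending
    to infinity. *)
Lemma qrec1_neq0 g n :
  (forall j, (j <= n)%N -> g j != 0) ->
  (forall j, (j < n)%N -> g j + g j.+1 != 0) ->
  (qrec g (fun=> 1) (fun=> 1) n).1 != 0 /\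
  (qrec g (fun=> 1) (fun=> 1) n).2 = g n * (qrec g (fun=> 1) (fun=> 1) n).1.
Proof.
elim: n => [|n IHn] g0 gD; first by rewrite /= oner_neq0 mulr1.
have [|j jn|x0 /= ->] := IHn.
- by move=> j jn; apply: g0; exact: leqW.
- by apply: gD; exact: leqW.
have gn := g0 n.+1 (leqnn _); set x := (qrec _ _ _ _).1 in x0 *.
split; last by field.
have -> : x + 1 / g n.+1 * (g n * x) = x * (g n + g n.+1) / g n.+1 by field.
by rewrite !mulf_neq0 ?invr_neq0 // gD.
Qed.

(** Each step divides only by its own [a j - s], so the product clears all denominators. *)
Lemma qrec_poly (a u v : nat -> F) n : exists P Q : {poly F},
  forall s, (forall j, (j <= n)%N -> a j - s != 0) ->
  (qrec (fun j => a j - s) u v n).1 * \prod_(i < n) (a i.+1 - s) = P.[s] /\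
  (qrec (fun j => a j - s) u v n).2 * \prod_(i < n) (a i.+1 - s) = Q.[s].
Proof.
elim: n => [|n [P [Q PQ]]].
  exists (u 0%N)%:P, ((a 0%N)%:P - 'X) => s _.
  by rewrite big_ord0 !mulr1 !hornerE.
pose g : {poly F} := (a n.+1)%:P - 'X.
exists (g * P + u n.+1 *: Q), (v n.+1 *: (g ^+ 2 * P) + g * Q) => s as0.
have [|eP eQ] := PQ s; first by move=> j jn; apply: as0; exact: leqW.
have an := as0 n.+1 (leqnn _).
have gs : g.[s] = a n.+1 - s by rewrite /g !hornerE.
rewrite big_ord_recr /=; split.
  by rewrite hornerD hornerZ hornerM gs -eP -eQ; field.
by rewrite hornerD hornerZ !hornerM gs -eP -eQ; ring.
Qed.

End Recursion.

Lemma qrec_gt0 (F : realFieldType) (g u v : nat -> F) n :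
  (forall j, (j <= n)%N -> [/\ 0 < g j, 0 < u j & 0 < v j]) ->
  0 < (qrec g u v n).1 /\ 0 < (qrec g u v n).2.
Proof.
elim: n => [|n IHn] guv; first by case: (guv 0%N).
have [j jn|x0 y0] := IHn; first by apply: guv; exact: leqW.
have [g0 u0 v0] := guv n.+1 (leqnn _).
by split=> /=; rewrite addr_gt0 ?mulr_gt0 ?invr_gt0.
Qed.

Lemma cvg_qrec (K : numFieldType) T (F : set_system T) {FF : Filter F}
    (g u v : T -> nat -> K) (g0 u0 v0 : nat -> K) n :
  (forall j, (j <= n)%N -> [/\ g0 j != 0, g x j @[x --> F] --> g0 j,
    u x j @[x --> F] --> u0 j & v x j @[x --> F] --> v0 j]) ->
  (qrec (g x) (u x) (v x) n).1 @[x --> F] --> (qrec g0 u0 v0 n).1 /\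
  (qrec (g x) (u x) (v x) n).2 @[x --> F] --> (qrec g0 u0 v0 n).2.
Proof.
elim: n => [|n IHn] guv; first by case: (guv 0%N).
have [j jn|x0 y0] := IHn; first by apply: guv; exact: leqW.
have [gn cg cu cv] := guv n.+1 (leqnn _).
split=> /=; apply: cvgD => //; apply: cvgM => //; apply: cvgM => //.
exact: cvgV.
Qed.

Lemma finite_poly_roots (F : idomainType) (P : {poly F}) :
  P != 0 -> finite_set [set x | P.[x] = 0].
Proof.
move=> P0; apply: contrapT => /(infinite_set_fset (size P)) [B BP].
apply/negP; rewrite -ltnNge; apply: max_poly_roots => //.
  by apply/allP => x /BP /eqP.
exact: finmap.fset_uniq.
Qed.

(** * From the matrix product to the recursion *)

Lemma q_tildeE (R : realType) (r : nat) (hr : (1 <= r)%N)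
    (gamma m : 'I_r.+1 -> R) :
  q_tilde gamma m = (qrec (gamma \o inord)
    (fun j => tq m (inord j) / m (inord j))
    (fun j => m (inord j) * tq m (inord j)) r).1.
Proof.
case: r hr gamma m => // r _ gamma m.
have iotaE n : rev (iota 1 n.+1) = n.+1 :: rev (iota 1 n).
  by rewrite -{1}(addn1 n) iotaD rev_cat add1n.
(* Here [r] is the predecessor of the original r. Through [val] the enumeration becomes 0, ..., r +
   1, and the filter drops both ends. *)
have listE : [seq j : 'I_r.+2 <- rev (enum 'I_r.+2) | (0 < j < r.+1)%N] =
    [seq inord i | i <- rev (iota 1 r)] :> seq 'I_r.+2.
  rewrite filter_rev map_rev; congr rev.
  rewrite -[LHS]map_id (eq_map (g := inord \o val));
    last by move=> i; rewrite /= inord_val.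
  rewrite map_comp -(filter_map val (fun i => 0 < i < r.+1)%N).
  rewrite val_enum_ord; congr map.
  have -> : iota 0 r.+2 = 0%N :: iota 1 r ++ [:: r.+1].
    by have := iotaD 1 r 1; rewrite addn1 add1n => /= ->.
  rewrite /= filter_cat /= ltnn cats0.
  apply/all_filterP/allP => i; rewrite mem_iota add1n.
  by case/andP=> ->.
rewrite /q_tilde -big_filter listE.
set g := _ \o _; set u := (fun j => _ / _); set v := (fun j => _ * _).
have sD x y : (x + y)%:M = x%:M + y%:M :> 'M[R]_1 by exact: raddfD.
have colE n : (\prod_(j <- [seq inord i | i <- rev (iota 1 n)])
    qmat gamma m j) *m qcol gamma m =
    (col_mx (qrec g u v n).1%:M (qrec g u v n).2%:M : 'cV_(1 + 1)).
  elim: n => [|n IHn].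
    rewrite big_nil -idmxE mul1mx /qcol.
    have e0 : inord 0 = ord0 :> 'I_r.+2 by apply: val_inj; rewrite /= inordK.
    by rewrite /= /u /g /= e0 mulrC.
  rewrite iotaE map_cons big_cons -mulmxE -mulmxA IHn.
  rewrite /qmat (@mul_block_col _ 1 1 1 1 1).
  rewrite -!scalar_mxM -!sD.
  rewrite mul1r; apply: (congr2 (fun x y : R => (col_mx x%:M y%:M : 'cV_(1 + 1)))).
    by rewrite /= /u /g /=; congr (_ + _ * _); ring.
  by rewrite /= /v /g /=; ring.
rewrite -mulmxA colE /qrow.
rewrite (@mul_row_col _ 1 1 1 1).
rewrite -!scalar_mxM -sD mul1r mxE eqxx mulr1n.
have -> : ord_max = inord r.+1 :> 'I_r.+2.
  by apply: val_inj; rewrite /= inordK.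
by rewrite [RHS]/= /g /u /=; congr (_ + _ * _); ring.
Qed.

(** * The hyperbolic tangent; separation of discrete sequences *)

Lemma tanh_gt0 (R : realType) (x : R) : 0 < x -> 0 < tanh x.
Proof.
move=> x0; apply: divr_gt0; last by rewrite addr_gt0 ?expR_gt0.
by rewrite subr_gt0 ltr_expR (lt_trans _ x0) // oppr_lt0.
Qed.

Lemma continuous_tanh (R : realType) : continuous (@tanh R).
Proof.
move=> x; have cN : expR (- y) @[y --> x] --> expR (- x).
  by apply: (@continuous_comp _ _ _ -%R expR); [exact: opp_continuous |
    exact: continuous_expR].
apply: cvgM; first by apply: cvgB => //; exact: continuous_expR.
apply: cvgV; last by apply: cvgD => //; exact: continuous_expR.
by rewrite gt_eqF // addr_gt0 ?expR_gt0.
Qed.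

Lemma cvgy_tanh (R : realType) : (@tanh R x) @[x --> +oo] --> (1 : R).
Proof.
(* Dividing through by e^x leaves only powers of e^(-x), which tend to 0. *)
have tanhE (x : R) : tanh x = (1 - expR (- x) ^+ 2) / (1 + expR (- x) ^+ 2).
  have e0 : expR x != 0 by rewrite gt_eqF ?expR_gt0.
  have e1 : expR x + expR (- x) != 0 by rewrite gt_eqF ?addr_gt0 ?expR_gt0.
  rewrite /tanh expRN in e1 *; field.
  rewrite e0 /=; apply: contra e1 => /eqP e.
  by apply/eqP; apply: (mulfI e0); rewrite mulr0 -[RHS]e; field.
have c2 : expR (- x) ^+ 2 @[x --> +oo] --> (0 : R).
  by rewrite -[X in _ --> X](mulr0 0); apply: cvgM; exact: cvgr_expR.
under eq_fun do rewrite tanhE.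
have cV : (1 + expR (- x) ^+ 2)^-1 @[x --> +oo] --> ((1 + 0)^-1 : R).
  by apply: cvgV; [rewrite addr0 oner_neq0 | exact: cvgD (cvg_cst _) c2].
have := cvgM (cvgB (cvg_cst (1 : R)) c2) cV;
  rewrite subr0 addr0 invr1 mulr1; exact.
Qed.

Lemma discrete_seq_separated (R : realType) (lam : nat -> R) :
  discrete_seq lam ->
  exists2 d, 0 < d & forall k k', lam k != lam k' -> d <= `|lam k - lam k'|.
Proof.
rewrite /discrete_seq; set S := [set _ | _] => S0.
have Sle k k' : lam k != lam k' -> (ereal_inf S <= `|lam k - lam k'|%:E)%E.
  move=> /eqP neq; apply: ereal_inf_lbound; exists (lam k), (lam k').
  by split.
case: (ereal_inf S) S0 Sle => // [d d0|_] Sle.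
  by exists d => // k k' /Sle; rewrite lee_fin.
(* An infimum +oo means that no two terms differ, so any positive bound serves. *)
by exists 1 => // k k' /Sle; rewrite leye_eq.
Qed.

(** * Joint limit of q~ in s, delta and lambda *)

Section Limit.
Variables (R : realType) (r : nat).
Hypothesis hr : (1 <= r)%N.
Variables (alpha : 'I_r.+1 -> R) (s t : R).
Hypothesis alpha_s : forall j, alpha j - s != 0.

(* x = ((s', delta), lambda); [F] is nbhs lambda or the filter at +oo. *)
Lemma cvg_q_tilde (F : set_system R) {FF : Filter F} (l0 : R) :
  (\forall l \near F, 0 < l) -> l^-1 @[l --> F] --> l0 ->
  (forall rho : R * R * R -> R,
    rho x @[x --> filter_prod (nbhs (s, 0 : R)) F] --> (1 : R) ->
    tanh (Num.sqrt x.2 * rho x * r.+1%:R^-1)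
      @[x --> filter_prod (nbhs (s, 0 : R)) F] --> t) ->
  Num.sqrt x.2 * q_tilde (fun j => alpha j - x.1.1)
      (fun j => Num.sqrt (x.2 + Num.sg (alpha j - x.1.1) * x.1.2))
    @[x --> filter_prod (nbhs (s, 0 : R)) F] -->
  (qrec (fun j => alpha (inord j) - s) (fun=> t) (fun=> t) r).1.
Proof.
move=> F0 Fl0 Ft.
set G := filter_prod _ F; have FG : Filter G by exact: filter_prod_filter.
pose rho (x : R * R * R) (j : 'I_r.+1) :=
  Num.sqrt (1 + Num.sg (alpha j - x.1.1) * x.1.2 / x.2).
pose T x j := tanh (Num.sqrt x.2 * rho x j * r.+1%:R^-1).
have cs : x.1.1 @[x --> G] --> s.
  apply: (@cvg_comp _ _ _ fst fst G (nbhs (s, 0 : R))); first exact: cvg_fst.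
  exact: cvg_fst.
have cd : x.1.2 @[x --> G] --> (0 : R).
  apply: (@cvg_comp _ _ _ fst snd G (nbhs (s, 0 : R))); first exact: cvg_fst.
  exact: cvg_snd.
have cl : x.2^-1 @[x --> G] --> l0.
  apply: (@cvg_comp _ _ _ snd GRing.inv G F) => //; exact: cvg_snd.
have crho j : rho x j @[x --> G] --> (1 : R).
  rewrite -{1}sqrtr1; apply: continuous_cvg; first exact: sqrt_continuous.
  rewrite -[X in _ --> X]addr0; apply: cvgD; first exact: cvg_cst.
  rewrite -(mul0r l0); apply: cvgM => //.
  (* Since |sgn| <= 1, the product is bounded by |delta|, whatever the sign does. *)
  apply/norm_cvg0P.
  have cd' : `|x.1.2| @[x --> G] --> (0 : R) by apply/norm_cvg0P.
  apply: squeeze_cvgr (cvg_cst 0) cd'; near=> x.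
  by rewrite normr_ge0 normrM normr_sg ler_piMl //; case: (_ != _).
have cT j : T x j @[x --> G] --> t by exact: Ft.
have [|c1 _] := @cvg_qrec _ _ G FG (fun x j => alpha (inord j) - x.1.1)
    (fun x j => T x (inord j) / rho x (inord j))
    (fun x j => rho x (inord j) * T x (inord j))
    (fun j => alpha (inord j) - s) (fun=> t) (fun=> t) r.
  move=> j _; split=> //; first exact: cvgB (cvg_cst _) cs.
    by have := cvgM (cT (inord j)) (cvgV (oner_neq0 R) (crho (inord j)));
      rewrite invr1 mulr1; exact.
  by have := cvgM (crho (inord j)) (cT (inord j)); rewrite mul1r; exact.
(* The normalized recursion agrees with the scaled q~ wherever lambda > 0, hence eventually. *)
apply: cvg_trans c1; apply: near_eq_cvg.
have G0 : \forall x \near G, 0 < x.2.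
  exact: (@cvg_snd _ _ (nbhs (s, 0 : R)) F _ _ F0).
near=> x; have x0 : 0 < x.2 by near: x.
have sx0 : Num.sqrt x.2 != 0 by rewrite gt_eqF // sqrtr_gt0.
have mE j : Num.sqrt (x.2 + Num.sg (alpha j - x.1.1) * x.1.2) =
    Num.sqrt x.2 * rho x j.
  by rewrite -sqrtrM ?ltW // mulrDr mulr1; congr (Num.sqrt (_ + _)); field;
    rewrite gt_eqF.
rewrite (funext mE).
rewrite q_tildeE //.
have scale g u v : (qrec g (fun j => Num.sqrt x.2 * u j)
    (fun j => v j / Num.sqrt x.2) r).1 = Num.sqrt x.2 * (qrec g u v r).1.
  by rewrite qrec_scale.
rewrite -scale.
congr (_.1); apply: eq_qrec => j _; split=> //; rewrite /tq -/(T x _).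
  by rewrite invfM mulrCA !mulrA mulfK // mulrC.
by rewrite [RHS]mulrC -mulrA mulKf.
Unshelve. all: by end_near.
Qed.

End Limit.

(** * Nonvanishing of q~ and the criterion near a point *)

Section Criterion.
Variables (R : realType) (r : nat).
Hypothesis hr : (1 <= r)%N.
Variable alpha : 'I_r.+1 -> R.

(** At delta = 0 every rho_j is 1, so after scaling [u] and [v] are one constant independent of
    s. *)
Lemma q_tilde_const (s l : R) : 0 < l ->
  Num.sqrt l * q_tilde (fun j => alpha j - s) (fun=> Num.sqrt l) =
  (qrec (fun j => alpha (inord j) - s)
    (fun=> tanh (Num.sqrt l * r.+1%:R^-1))
    (fun=> tanh (Num.sqrt l * r.+1%:R^-1)) r).1.
Proof.
move=> l0; have sl0 : Num.sqrt l != 0 by rewrite gt_eqF // sqrtr_gt0.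
rewrite q_tildeE //.
transitivity (Num.sqrt l * (qrec (fun j => alpha (inord j) - s)
    (fun=> tanh (Num.sqrt l * r.+1%:R^-1) / Num.sqrt l)
    (fun=> Num.sqrt l * tanh (Num.sqrt l * r.+1%:R^-1)) r).1) => //.
transitivity (qrec (fun j => alpha (inord j) - s)
    (fun=> Num.sqrt l * (tanh (Num.sqrt l * r.+1%:R^-1) / Num.sqrt l))
    (fun=> Num.sqrt l * tanh (Num.sqrt l * r.+1%:R^-1) / Num.sqrt l) r).1.
  by rewrite (qrec_scale _ (fun=> tanh (Num.sqrt l * r.+1%:R^-1) / Num.sqrt l)
    (fun=> Num.sqrt l * tanh (Num.sqrt l * r.+1%:R^-1))).
congr (_.1); apply: eq_qrec => j _; split=> //; first by rewrite mulrC divfK.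
by rewrite mulrC mulKf.
Qed.

Lemma finite_zeros (l : R) : 0 < l ->
  finite_set [set s | (forall j, alpha j - s != 0) /\
    q_tilde (fun j => alpha j - s) (fun=> Num.sqrt l) = 0].
Proof.
move=> l0; set t := tanh (Num.sqrt l * r.+1%:R^-1).
have t0 : 0 < t by rewrite tanh_gt0 // divr_gt0 ?sqrtr_gt0 ?ltr0n.
have [P [P' PQ]] := qrec_poly (fun j => alpha (inord j)) (fun=> t) (fun=> t) r.
have PE s : (forall j, alpha j - s != 0) ->
    Num.sqrt l * q_tilde (fun j => alpha j - s) (fun=> Num.sqrt l) *
      \prod_(i < r) (alpha (inord i.+1) - s) = P.[s].
  by move=> as0; rewrite q_tilde_const //; case: (PQ s).
apply: (@sub_finite_set _ _ [set s | P.[s] = 0]).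
  by move=> s /= [as0 q0]; rewrite -PE // q0 mulr0 mul0r.
apply: finite_poly_roots; apply/eqP => P0.
(* This s is at most -1 - |alpha_j| for every j, so all alpha_j - s are positive. *)
pose s := - (1 + \sum_j `|alpha j|).
have as0 j : 0 < alpha j - s.
  rewrite opprK (bigD1 j) //=.
  have : 0 <= \sum_(i | i != j) `|alpha i| by rewrite sumr_ge0.
  by have := ler_norm (- alpha j); rewrite normrN; lra.
have := PE s (fun j => lt0r_neq0 (as0 j)); rewrite P0 horner0 q_tilde_const //.
apply/eqP; rewrite gt_eqF // mulr_gt0 ?prodr_gt0 //.
by apply: (qrec_gt0 _).1.
Qed.

Let Q (s delta l : R) := q_tilde (fun j => alpha j - s)
  (fun j => Num.sqrt (l + Num.sg (alpha j - s) * delta)).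

(** Joint continuity at (s, 0, l), read on the slice lambda = l. The bound [|x.2| < l] later yields
    delta0 < lambda_k. *)
Lemma near_q_tilde_neq0 (s l : R) : (forall j, alpha j - s != 0) -> 0 < l ->
  q_tilde (fun j => alpha j - s) (fun=> Num.sqrt l) != 0 ->
  \forall x \near (s, 0 : R), `|x.2| < l /\ Q x.1 x.2 l != 0.
Proof.
move=> as0 l0 q0; have sl0 : 0 < Num.sqrt l by rewrite sqrtr_gt0.
have cQ : Num.sqrt x.2 * Q x.1.1 x.1.2 x.2
    @[x --> filter_prod (nbhs (s, 0 : R)) (nbhs l)] -->
    Num.sqrt l * q_tilde (fun j => alpha j - s) (fun=> Num.sqrt l).
  rewrite q_tilde_const //; apply: (cvg_q_tilde hr as0 (l0 := l^-1)).
  - exact: lt_nbhsr.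
  - by apply: cvgV => //; rewrite gt_eqF.
  move=> rho rho1; apply: continuous_cvg; first exact: continuous_tanh.
  have cl : x.2 @[x --> filter_prod (nbhs (s, 0 : R)) (nbhs l)] --> l.
    exact: cvg_snd.
  apply: cvgM; last exact: cvg_cst.
  rewrite -[X in _ --> X]mulr1; apply: cvgM => //.
  by apply: (cvg_comp _ _ cl); exact: sqrt_continuous.
have /(cvgr_neq0 _ cQ) [[U V] [/= sU lV] UV] : Num.sqrt l *
    q_tilde (fun j => alpha j - s) (fun=> Num.sqrt l) != 0.
  by rewrite mulf_neq0 // gt_eqF.
near=> x; split.
  near: x; have : `|x.2| @[x --> nbhs (s, 0 : R)] --> `|0 : R|.
    apply: cvg_norm; exact: cvg_snd.
  rewrite normr0 => /cvgr_lt; exact.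
have /UV /= : (U `*` V) (x, l) by split=> //=; [near: x | exact: nbhs_singleton].
by rewrite mulf_eq0 negb_or => /andP[].
Unshelve. all: by end_near.
Qed.

(** A set of the product filter contains a rectangle, so one neighbourhood of (s, 0) serves all
    large l at once. *)
Lemma near_q_tilde_neq0_pinfty (s : R) : (forall j, alpha j - s != 0) ->
  (forall j, (j < r)%N ->
    (alpha (inord j) - s) + (alpha (inord j.+1) - s) != 0) ->
  exists L : R, \forall x \near (s, 0 : R), forall l, L < l ->
    `|x.2| < l /\ Q x.1 x.2 l != 0.
Proof.
move=> as0 ss0.
have cQ : Num.sqrt x.2 * Q x.1.1 x.1.2 x.2
    @[x --> filter_prod (nbhs (s, 0 : R)) +oo] -->
    (qrec (fun j => alpha (inord j) - s) (fun=> 1) (fun=> 1) r).1.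
  apply: (cvg_q_tilde hr as0 (l0 := 0)).
  - exact: nbhs_pinfty_gt.
  - by apply/(gtr0_cvgV0 (nbhs_pinfty_gt (num_real 0))); exact: cvg_id.
  move=> rho rho1.
  suff cy : Num.sqrt x.2 * rho x * r.+1%:R^-1
      @[x --> filter_prod (nbhs (s, 0 : R)) +oo] --> (+oo : set_system R).
    exact: (cvg_comp _ _ cy (@cvgy_tanh R)).
  have csqrt : Num.sqrt l @[l --> +oo] --> (+oo : set_system R).
    apply/cvgryPge => B; near=> l.
    have Bl : B ^+ 2 <= l by near: l; exact: nbhs_pinfty_ge (num_real _).
    by rewrite (le_trans (ler_norm B)) // -sqrtr_sqr ler_wsqrtr.
  (* Eventually rho >= 1/2, so half of h sqrt(lambda) bounds the argument of tanh from below. *)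
  have h0 : 0 < 2^-1 * r.+1%:R^-1 :> R by rewrite mulr_gt0 // invr_gt0 ltr0n.
  have cy : 2^-1 * r.+1%:R^-1 * Num.sqrt x.2
      @[x --> filter_prod (nbhs (s, 0 : R)) +oo] --> (+oo : set_system R).
    have cM : 2^-1 * r.+1%:R^-1 * Num.sqrt l @[l --> +oo] -->
        (+oo : set_system R) by exact: gt0_cvgMry.
    exact: (cvg_comp _ _ cvg_snd cM).
  apply: ger_cvgy cy; near=> x.
  rewrite mulrAC ler_wpM2r ?invr_ge0 ?ler0n //.
  rewrite mulrC ler_wpM2l ?sqrtr_ge0 //; near: x.
  by have /cvgr_ge := rho1; apply; lra.
have /(cvgr_neq0 _ cQ) [[U V] [/= sU [L [_ LV]]] UV] :=
  (qrec1_neq0 (fun j _ => as0 (inord j)) ss0).1.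
(* The 1 gives |delta| < 1 < l near delta = 0. *)
exists (Num.max 1 L); near=> x => l; rewrite gt_max => /andP[l1 Ll].
split.
  apply: lt_trans l1; near: x.
  have : `|x.2| @[x --> nbhs (s, 0 : R)] --> `|0 : R|.
    apply: cvg_norm; exact: cvg_snd.
  rewrite normr0 => /cvgr_lt; apply; exact: ltr01.
have /UV /= : (U `*` V) (x, l) by split=> //=; [near: x | exact: LV].
by rewrite mulf_eq0 negb_or => /andP[].
Unshelve. all: by end_near.
Qed.

Lemma near_criterion (lam : nat -> R) (s : R) :
  (forall k, 0 < lam k) -> discrete_seq lam ->
  (forall j, alpha j - s != 0) ->
  (forall j, (j < r)%N ->
    (alpha (inord j) - s) + (alpha (inord j.+1) - s) != 0) ->
  (forall k, q_tilde (fun j => alpha j - s) (fun=> Num.sqrt (lam k)) != 0) ->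
  \forall s' \near s, q_tilde_criterion (fun j => alpha j - s') lam.
Proof.
move=> lam0 /discrete_seq_separated [d d0 lamd] as0 ss0 qs0.
have [L near_large] := near_q_tilde_neq0_pinfty as0 ss0.
pose good (x : R * R) l := `|x.2| < l /\ Q x.1 x.2 l != 0.
(* The cells [i d, (i + 1) d) with i < n cover all values lambda_k <= L, and each holds at most one
   value, so finitely many neighbourhoods are intersected. *)
pose n := (Num.truncn (L / d)).+1.
have near_small : \forall x \near (s, 0 : R), forall i : 'I_n,
    forall k, Num.truncn (lam k / d) = i -> good x (lam k).
  apply: (@filter_forall (R * R)%type 'I_n (fun i x => forall k,
    Num.truncn (lam k / d) = i -> good x (lam k)) (nbhs (s, 0 : R)) _) => i.
  have [[k0 k0i]|noi] := pselect (exists k, Num.truncn (lam k / d) = i); last first.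
    by apply: nearW => x k ki; case: noi; exists k.
  apply: filterS (near_q_tilde_neq0 as0 (lam0 k0) (qs0 k0)) => x goodx k ki.
  suff -> : lam k = lam k0 by [].
  (* Two values in one cell differ by less than d, hence coincide. *)
  apply/eqP/negPn/negP => /lamd; apply/negP; rewrite -ltNge.
  have lt k1 : 0 <= lam k1 / d by rewrite divr_ge0 // ltW.
  have := truncn_itv (lt k); have := truncn_itv (lt k0).
  rewrite ki k0i -natr1 !ler_pdivlMr // !ltr_pdivrMr // mulrDl mul1r.
  by move=> /andP[? ?] /andP[? ?]; rewrite ltr_norml; apply/andP; split; lra.
have : \forall x \near (s, 0 : R), forall k, good x (lam k).
  apply: filterS2 near_large near_small => x large small k.
  have [/large //|lamL] := ltP L (lam k).
  have lt : (Num.truncn (lam k / d) < n)%N.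
    by rewrite ltnS le_truncn // ler_pM2r // invr_gt0.
  exact: (small (Ordinal lt)).
move=> [[U V] [/= sU] /nbhs_ballP [e /= e0 eV] UV].
(* Half the radius keeps the closed interval of the criterion inside the open ball. *)
apply: filterS sU => s' Us'; exists (e / 2).
have good' delta k : - (e / 2) <= delta <= e / 2 -> good (s', delta) (lam k).
  move=> de; apply: (UV (s', delta)); split=> //=; apply: eV.
  rewrite /ball /= sub0r normrN.
  by apply: (@le_lt_trans _ _ (e / 2)); [rewrite ler_norml | lra].
have ee : - (e / 2) <= e / 2 <= e / 2 by apply/andP; split; lra.
split; first by lra.
  by move=> k; have [/= lt _] := good' _ k ee; exact: le_lt_trans (ler_norm _) lt.
by move=> delta de k; case: (good' _ k de).
Qed.

End Criterion.

(** The intersection contains a nondegenerate interval, of positive Lebesgue measure, whereas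
    countable sets are null. *)
Lemma uncountable_subspace_nbhs (R : realType) (A s : R) (B : set R) :
  0 < A -> s \in `[- A, A] -> nbhs s B -> ~ countable (`[- A, A] `&` B).
Proof.
move=> A0; rewrite in_itv /= => /andP[As sA] /nbhs_ballP [e /= e0 eB] cB.
have [a [b [ab sub]]] : exists a b, a < b /\ `]a, b[ `<=` `[- A, A] `&` B.
  (* The interval extends to the right of s, except at s = A, where it extends to the left. *)
  have [sltA|Ales] := ltP s A.
    exists s, (Num.min A (s + e)); split; first by rewrite lt_min sltA ltrDl.
    move=> x /=; rewrite !in_itv /= lt_min => /andP[sx /andP[xA xe]]; split.
      by apply/andP; split; lra.
    apply: eB; rewrite /ball /= ltr_norml; apply/andP; split; lra.
  exists (Num.max (- A) (s - e)), s; split.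
    by rewrite gt_max; apply/andP; split; lra.
  move=> x /=; rewrite !in_itv /= gt_max => /andP[/andP[xA xe] sx]; split.
    by apply/andP; split; lra.
  apply: eB; rewrite /ball /= ltr_norml; apply/andP; split; lra.
have := countable_lebesgue_measure0 (sub_countable (subset_card_le sub) cB).
rewrite lebesgue_measure_itv /= lte_fin ab -EFinD => /eqP.
by rewrite eqe subr_eq0 gt_eqF.
Qed.

(** * The countable exceptional set and the closure of the complement of W *)

Theorem theorem8p1 (R : realType) (r : nat) (hr : (1 <= r)%N)
    (alpha : 'I_r.+1 -> R) (halpha : forall j, alpha j != 0)
    (A : R) (hA : \big[Num.max/0]_(j < r.+1) `|alpha j| < A)
    (lam : nat -> R) (hlam_pos : forall k, 0 < lam k)
    (hlam : discrete_seq lam) :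
  exists N : set (subspace `[- A, A]%classic),
    [/\ W alpha A lam = `[- A, A]%classic `\` N,
        N `<=` `[- A, A]%classic,
        nowhere_dense N
      & countable N].
Proof.
have A0 : 0 < A by rewrite (le_lt_trans _ hA) // bigmax_ge_id.
pose zeros k := [set s | (forall j, alpha j - s != 0) /\
  q_tilde (fun j => alpha j - s) (fun=> Num.sqrt (lam k)) = 0].
(* Beyond r, [inord] defaults to index 0; the extra points leave [range mid] countable. *)
pose mid j := (alpha (inord j) + alpha (inord j.+1)) / 2.
pose M := range alpha `|` (range mid `|` \bigcup_k zeros k).
have Mc : countable M.
  rewrite /M -!bigcup2E; apply: bigcup_countable => // -[|[|n]] _ /=.
  - exact: sub_countable (card_image_le _ _) (countableP _).
  - apply: bigcup_countable => // -[|[|m]] _ /=.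
    + exact: sub_countable (card_image_le _ _) (countableP _).
    + apply: bigcup_countable => // k _; apply: finite_set_countable.
      exact: finite_zeros.
    + exact: countable0.
  - exact: countable0.
(* Because W contains a relative neighbourhood of s, and not only s, [M] captures the closure of [N]
   as well. *)
have near_W s : ~ M s -> \forall s' \near s, s' \in `[- A, A] -> W alpha A lam s'.
  move=> Ms.
  have as0 j : alpha j - s != 0.
    by rewrite subr_eq0; apply/eqP => e; apply: Ms; left; exists j.
  have near_a : \forall s' \near s, forall j, alpha j - s' != 0.
    apply: (@filter_forall R 'I_r.+1 (fun j s' => alpha j - s' != 0)
      (nbhs s) _) => j.
    have ca : alpha j - s' @[s' --> s] --> alpha j - s.
      exact: cvgB (cvg_cst _) cvg_id.
    exact: cvgr_neq0 ca (as0 j).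
  apply: filterS2 near_a (near_criterion hr hlam_pos hlam as0 _ _).
  - move=> s' as' crit s'A; split=> // -[j _ /eqP].
    by rewrite -subr_eq0 (negPf (as' j)).
  - move=> j _; apply/eqP => e; apply: Ms; right; left; exists j => //.
    by rewrite /mid; lra.
  - by move=> k; apply/eqP => e; apply: Ms; right; right; exists k.
pose N : set (subspace `[- A, A]%classic) := `[- A, A]%classic `\` W alpha A lam.
have nbhsE s : s \in `[- A, A] ->
    nbhs (s : subspace `[- A, A]%classic) = within `[- A, A]%classic (nbhs s).
  by move=> sA; exact: esym (@nbhs_subspace_in R `[- A, A]%classic s sA).
have clN s : s \in `[- A, A] -> closure N s -> M s.
  move=> sA clNs; apply: contrapT => /near_W Ws.
  have : nbhs (s : subspace `[- A, A]%classic) (W alpha A lam).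
    by rewrite nbhsE.
  by move=> /clNs [s' [[_ +]]].
exists N; split.
- by rewrite /N setDD; apply/esym/setIidr => s -[[]].
- by move=> s [].
- apply/seteqP; split=> // s /=; rewrite /interior => sN.
  (* A point outside the interval is isolated in the subspace topology, so {s} would have to meet
     [N]. *)
  have [sA|sA] := pselect (s \in `[- A, A]); last first.
    have [|s' [[s'A _] s's]] := nbhs_singleton sN [set s].
      by rewrite -(@nbhs_subspace_out R `[- A, A]%classic s sA
        : _ = nbhs (s : subspace `[- A, A]%classic)).
    by apply: sA; rewrite -(s's : s' = s).
  move: sN; rewrite nbhsE // => sN.
  (* An uncountable relative neighbourhood of s would lie in the closure of [N], hence in [M]. *)
  apply: (uncountable_subspace_nbhs A0 sA sN).
  apply: sub_countable Mc; apply: subset_card_le => x [xA xN].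
  by apply: clN => //; exact: xN.
- apply: sub_countable Mc; apply: subset_card_le => s Ns.
  by apply: clN; [case: Ns | exact: subset_closure].
Qed.
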